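(* Let $s\ge 2$ be an integer, let $x_1,\dots,x_s\ge 2$ be integers, and let $\eta_1,\eta_2\in\mathbb{Z}^+$. Put $X=\prod_{i=1}^s x_i$, $K=\sum_{i=1}^s x_i$, $N=\eta_1X$ and $Q=\eta_2X$, and consider the cascaded coded distributed computing network with $K$ nodes, $N$ input files, $Q$ output functions, each output function being computed at $s$ nodes, with the combinatorial file and function assignment with parameters $(s;x_1,\dots,x_s;\eta_1,\eta_2)$ defined in the context. Then the following computation and communication load pair is achievable with this assignment: $$r_{\rm c}=s,$$ $$L_{\rm c}(r_{\rm c},s)=\frac{1}{2X}\sum_{\gamma=1}^{s-1}\ \sum_{\substack{\mathcal{A}\subset[s]\\ |\mathcal{A}|=\gamma}}\ \prod_{i\in\mathcal{A}}(x_i-1)\;+\;\frac{s}{X(2s-1)}\prod_{i=1}^{s}(x_i-1),$$ where $[s]=\{1,\dots,s\}$.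
   Context: **Network model.** There are $K$ nodes $\{1,\dots,K\}$, $N$ input files $w_1,\dots,w_N$ of equal size, and $Q$ output functions $\phi_1,\dots,\phi_Q$, each of which depends on all $N$ files. Each output $u_i=\phi_i(w_1,\dots,w_N)$ decomposes as $u_i=h_i(g_{i,1}(w_1),\dots,g_{i,N}(w_N))$ with Map functions $g_{i,j}$ and Reduce function $h_i$. The intermediate values $v_{i,j}=g_{i,j}(w_j)$, $1\le i\le Q$, $1\le j\le N$, are $T$ bits each and are treated as arbitrary elements of $\{0,1\}^T$. Node $k$ stores a set of files $\mathcal{M}_k\subseteq\{w_1,\dots,w_N\}$ and is assigned a set of functions $\mathcal{W}_k\subseteq\{1,\dots,Q\}$. **Map phase.** Node $k$ computes all $v_{i,j}$ with $w_j\in\mathcal{M}_k$ and $i\in\{1,\dots,Q\}$. **Shuffle phase.** Over an error-free shared link, each node $k$ multicasts to all other nodes a message of some fixed length in bits that is a function of the intermediate values it computed in the Map phase. **Reduce phase.** From the multicast messages and its own computed intermediate values, each node $k$ must recover all $v_{i,j}$ with $i\in\mathcal{W}_k$ and $j\in\{1,\dots,N\}$, for every possible realization of the intermediate values. It then computes $u_i$ for $i\in\mathcal{W}_k$. **Loads.** The computation load $r$ is the total number of intermediate values computed in the Map phase, summed over all nodes, divided by $QN$. The communication load $L$ is the total number of bits multicast in the Shuffle phase divided by $QNT$. A pair $(r,L)$ is achievable with a given file and function assignment if, for some $T\in\mathbb{Z}^+$, the assignment together with the Map phase in which each node $k$ computes all $v_{i,j}$ with $w_j\in\mathcal{M}_k$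 and $i\in\{1,\dots,Q\}$ has computation load $r$ and there is a Shuffle scheme with communication load $L$ for which the Reduce phase succeeds. The size $T$ may be chosen so that intermediate values can be split into equal-size packets and linear combinations of packets can be taken over a sufficiently large finite field. **Combinatorial file and function assignment with parameters $(s;x_1,\dots,x_s;\eta_1,\eta_2)$.** The $K=\sum_i x_i$ nodes are partitioned into disjoint sets $\mathcal{K}_1,\dots,\mathcal{K}_s$ with $|\mathcal{K}_i|=x_i$. Let $\mathcal{T}_1,\dots,\mathcal{T}_X$, $X=\prod_i x_i$, be all the node sets $\mathcal{T}\subseteq\{1,\dots,K\}$ with $|\mathcal{T}\cap\mathcal{K}_i|=1$ for all $i\in\{1,\dots,s\}$. The $N=\eta_1X$ files are partitioned into disjoint sets $\mathcal{B}_1,\dots,\mathcal{B}_X$ of size $\eta_1$ each, and the $Q=\eta_2X$ output functions into disjoint sets $\mathcal{D}_1,\dots,\mathcal{D}_X$ of size $\eta_2$ each. Every node in $\mathcal{T}_i$ stores the files of $\mathcal{B}_i$ and is assigned the functions of $\mathcal{D}_i$; that is, $\mathcal{M}_k=\bigcup_{i:\,k\in\mathcal{T}_i}\mathcal{B}_i$ and $\mathcal{W}_k=\bigcup_{i:\,k\in\mathcal{T}_i}\mathcal{D}_i$. *)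

(* Defs.v *)
From mathcomp Require Import all_boot all_order all_algebra.

Set Implicit Arguments.
Unset Strict Implicit.
Unset Printing Implicit Defensive.

Import GRing.Theory Num.Theory.

Local Open Scope ring_scope.

(* Nodes are 'I_K, files 'I_N and output functions 'I_Q; the pair (i, j) of a
   function and a file indexes the intermediate value v_{i,j}. *)

Definition storage (K N : nat) := 'I_K -> {set 'I_N}.
Definition functions (K Q : nat) := 'I_K -> {set 'I_Q}.

Definition bits (n : nat) := n.-tuple bool.

Definition realization (Q N T : nat) := {ffun 'I_Q * 'I_N -> bits T}.

Definition values_on (Q N T : nat) (P : {set 'I_Q * 'I_N}) :=
  {ffun {p : 'I_Q * 'I_N | p \in P} -> bits T}.

Definition restrict (Q N T : nat) (P : {set 'I_Q * 'I_N})
    (v : realization Q N T) : values_on T P :=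
  [ffun p => v (val p)].

Definition mapped (K N Q : nat) (M : storage K N) (k : 'I_K) :
    {set 'I_Q * 'I_N} :=
  [set p | p.2 \in M k].

Definition required (K N Q : nat) (W : functions K Q) (k : 'I_K) :
    {set 'I_Q * 'I_N} :=
  [set p | p.1 \in W k].

(* The locality of encoding and decoding is enforced by typing: node k only
   has access to the restriction of the realization to the values it mapped.
   The family of messages passed to the decoder of node k includes the message
   of k itself, which k can compute anyway. *)
Record shuffle_scheme (K N Q : nat) (M : storage K N) (W : functions K Q)
    (T : nat) := ShuffleScheme {
  msg_len : 'I_K -> nat;
  encode : forall k, values_on T (mapped Q M k) -> bits (msg_len k);
  decode : forall k, (forall l, bits (msg_len l)) ->
    values_on T (mapped Q M k) -> values_on T (required N W k)
}.

Arguments encode {K N Q M W T} _ k _.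
Arguments decode {K N Q M W T} _ k _ _.

Definition messages (K N Q : nat) (M : storage K N) (W : functions K Q)
    (T : nat) (S : shuffle_scheme M W T) (v : realization Q N T) (k : 'I_K) :
    bits (msg_len S k) :=
  encode S k (restrict (mapped Q M k) v).

Definition reduce_succeeds (K N Q : nat) (M : storage K N) (W : functions K Q)
    (T : nat) (S : shuffle_scheme M W T) : Prop :=
  forall (v : realization Q N T) (k : 'I_K),
    decode S k (messages S v) (restrict (mapped Q M k) v)
      = restrict (required N W k) v.

Definition computation_load (K N : nat) (Q : nat) (M : storage K N) : rat :=
  (\sum_(k < K) #|mapped Q M k|)%N%:R / (Q * N)%N%:R.

Definition communication_load (K N Q : nat) (M : storage K N)
    (W : functions K Q) (T : nat) (S : shuffle_scheme M W T) : rat :=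
  (\sum_(k < K) msg_len S k)%N%:R / (Q * N * T)%N%:R.

Definition achievable (K N Q : nat) (M : storage K N) (W : functions K Q)
    (r L : rat) : Prop :=
  exists T : nat, (0 < T)%N /\
    computation_load Q M = r /\
    exists S : shuffle_scheme M W T,
      reduce_succeeds S /\ communication_load S = L.

Definition partition_family (I U : finType) (F : I -> {set U}) : Prop :=
  (forall i j, i != j -> [disjoint F i & F j]) /\ \bigcup_i F i = [set: U].

Record combinatorial_assignment (K N Q s : nat) (x : 'I_s -> nat)
    (eta1 eta2 : nat) := CombinatorialAssignment {
  group : 'I_s -> {set 'I_K};
  group_partition : partition_family group;
  card_group : forall i, #|group i| = x i;
  transv : 'I_(\prod_(i < s) x i) -> {set 'I_K};
  transv_inj : injective transv;
  transv_all : forall S : {set 'I_K},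
    (exists a, transv a = S) <-> (forall i, #|S :&: group i| = 1%N);
  file_block : 'I_(\prod_(i < s) x i) -> {set 'I_N};
  file_partition : partition_family file_block;
  card_file_block : forall a, #|file_block a| = eta1;
  fun_block : 'I_(\prod_(i < s) x i) -> {set 'I_Q};
  fun_partition : partition_family fun_block;
  card_fun_block : forall a, #|fun_block a| = eta2
}.

Definition comb_storage (K N Q s : nat) (x : 'I_s -> nat) (eta1 eta2 : nat)
    (C : combinatorial_assignment K N Q x eta1 eta2) : storage K N :=
  fun k => \bigcup_(a | k \in transv C a) file_block C a.

Definition comb_functions (K N Q s : nat) (x : 'I_s -> nat) (eta1 eta2 : nat)
    (C : combinatorial_assignment K N Q x eta1 eta2) : functions K Q :=
  fun k => \bigcup_(a | k \in transv C a) fun_block C a.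

(* Main.v *)
(* Identify a transversal with its vector of coordinates (its node in each
   group), and let v(a, b) be a value of a function of block a on a file of
   block b; it is known at the nodes of b and needed at those of a.
   If a <> b share a node, that node multicasts v(a, b) + v(b, a): every node
   needing one of the two summands knows the other unless it already knows
   both. This costs one value per unordered pair.
   If a and b have no common node, split v(a, b) into 2 s - 1 bits
   c_0, ..., c_(s-1), d_1, ..., d_(s-1), put d_0 = 0, and let the j-th node of
   b multicast the bit c_j(a, b) + sum_(l <> j) (d_j + d_l)(a^l, b^l), where
   a^l, b^l arise from a, b by exchanging their l-th coordinates. For the i-th
   node of a, the j-th message for (a^i, b^i) contains only known terms besides
   (d_j + d_i)(a, b). So this node first recovers all the d's, and then the
   messages for (a, b) itself give the c's. Thus [T = 2 s - 1] suffices, with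
   coefficients in the field with two elements. *)
Require Import Defs.
From mathcomp Require Import all_boot all_order all_algebra.
From mathcomp Require Import ring.

Set Implicit Arguments.
Unset Strict Implicit.
Unset Printing Implicit Defensive.

Import GRing.Theory Num.Theory.

Local Open Scope ring_scope.

(** * Shuffle schemes from families of multicast bits *)

Section SchemeOfBits.

Variables (K N Q T : nat) (M : storage K N) (W : functions K Q).
Variables (I : finType) (owner : I -> 'I_K) (f : I -> realization Q N T -> bool).

Hypothesis f_local : forall m v v',
  restrict (mapped Q M (owner m)) v = restrict (mapped Q M (owner m)) v' ->
  f m v = f m v'.

Hypothesis f_decodable : forall k v v',
  restrict (mapped Q M k) v = restrict (mapped Q M k) v' ->
  f^~ v =1 f^~ v' ->
  restrict (required N W k) v = restrict (required N W k) v'.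

Let owned (k : 'I_K) : {set I} := [set m | owner m == k].

(** Zero filling lets [f], which takes full realizations, be evaluated from local values; by
    [f_local] the filling does not affect the bits that a node owns. *)
Let extend (P : {set 'I_Q * 'I_N}) (u : values_on T P) : realization Q N T :=
  [ffun p => if insub p is Some q then u q else [tuple of nseq T false]].

Let restrict_extend P (u : values_on T P) : restrict P (extend u) = u.
Proof. by apply/ffunP=> q; rewrite !ffunE valK. Qed.

Let enc k (u : values_on T (mapped Q M k)) : bits #|owned k| :=
  [tuple f (enum_val r) (extend u) | r < #|owned k|].

Let dec k (msg : forall l, bits #|owned l|) (u : values_on T (mapped Q M k)) :
    values_on T (required N W k) :=
  restrict (required N W k) (odflt (extend u)
    [pick v | (restrict (mapped Q M k) v == u)
            && [forall l, enc (restrict (mapped Q M l) v) == msg l]]).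

Let enc_restrict (v v' : realization Q N T) :
  (forall l, enc (restrict (mapped Q M l) v) =
             enc (restrict (mapped Q M l) v')) -> f^~ v =1 f^~ v'.
Proof.
move=> eq_enc m; have m_owned : m \in owned (owner m) by rewrite inE.
have local w : f m (extend (restrict (mapped Q M (owner m)) w)) = f m w.
  by apply: f_local; rewrite restrict_extend.
have := congr1 (fun t => tnth t (enum_rank_in m_owned m)) (eq_enc (owner m)).
by rewrite !tnth_mktuple enum_rankK_in // !local.
Qed.

(** Decoding reduces to injectivity: node [k] may pick any realization consistent with its own
    values and all messages, since by [f_decodable] all of these agree on the required values. The
    true realization is one of them. *)
Lemma scheme_of_bits : exists S : shuffle_scheme M W T,
  reduce_succeeds S /\ (\sum_(k < K) msg_len S k)%N = #|I|.
Proof.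
exists (ShuffleScheme enc dec); split; last first.
  rewrite /= -sum1_card (partition_big owner predT) //=.
  by apply: eq_bigr => k _; rewrite -sum1_card; apply: eq_bigl => m; rewrite inE.
move=> v k; rewrite /= /dec; case: pickP => [v' | /(_ v)] /=.
  case/andP=> /eqP eq_k /forallP eq_l; apply: f_decodable => //.
  by apply: enc_restrict => l; apply/eqP.
by rewrite eqxx /=; case/forallP.
Qed.

End SchemeOfBits.

(** * Coordinates of blocks and transversals *)

Lemma block_index (D U : finType) (F : D -> {set U}) (eta : nat) :
  partition_family F -> (forall a, #|F a| = eta) ->
  exists g : D -> 'I_eta -> U,
    (forall a e, g a e \in F a) /\ (forall u, exists a e, g a e = u).
Proof.
move=> [_ covF] cardF.
exists (fun a e => enum_val (cast_ord (esym (cardF a)) e)); split=> [a e|u].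
  exact: enum_valP.
have /bigcupP[a _ Fau] : u \in \bigcup_a F a by rewrite covF inE.
exists a, (cast_ord (cardF a) (enum_rank_in Fau u)).
by rewrite cast_ordK enum_rankK_in.
Qed.

Lemma coordinates (K N Q s : nat) (x : 'I_s -> nat) (eta1 eta2 : nat)
    (C : combinatorial_assignment K N Q x eta1 eta2) :
  exists node : 'I_(\prod_(i < s) x i) -> 'I_s -> 'I_K,
    [/\ forall a i, node a i \in group C i,
        forall p, (forall i, p i \in group C i) -> exists a, node a =1 p,
        forall a b, node a =1 node b -> a = b
      & forall a, transv C a = [set node a i | i : 'I_s]].
Proof.
have [disjG covG] := group_partition C.
have meet a i : exists k, transv C a :&: group C i = [set k].
  by apply/cards1P/eqP; apply: (transv_all C _).1; exists a.
have [node nodeE] := fin_all_exists (fun a => fin_all_exists (meet a)).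
have node_in a i : node a i \in transv C a :&: group C i.
  by rewrite nodeE set11.
have transvE a : transv C a = [set node a i | i : 'I_s].
  apply/setP=> k; apply/idP/imsetP=> [ka | [i _ ->]].
    have /bigcupP[i _ ki] : k \in \bigcup_i group C i by rewrite covG inE.
    exists i => //; apply/set1P; rewrite -nodeE inE ka.
    exact: ki.
  by have /setIP[] := node_in a i.
exists node; split=> // [a i | p pG | a b eq_ab].
- by have /setIP[] := node_in a i.
(* As the groups are disjoint, the image of [p] meets the [i]-th group only in [p i], so it is a
   transversal. *)
- have [|a aE] := (transv_all C [set p i | i : 'I_s]).2.
    move=> i; apply/eqP/cards1P; exists (p i); apply/setP=> k; rewrite !inE.
    apply/andP/eqP=> [[/imsetP[j _ ->] pji] | ->]; last by rewrite imset_f.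
    by case: (eqVneq j i) => [-> //|/disjG/disjointFr/(_ (pG j))]; rewrite pji.
  exists a => i; apply/esym/set1P; rewrite -nodeE aE inE imset_f //=.
- apply: (transv_inj (c := C)); rewrite !transvE; apply: eq_imset => i.
  exact: eq_ab.
Qed.

(** * Splitting a value into bits *)

Section Packets.

Variable n : nat.
Local Notation T := (n.+1 + n)%N.

(* The [2 s - 1] bits of a value are labelled [c_0, ..., c_(s-1)] and
   [d_1, ..., d_(s-1)]; the convention [d_0 = 0] makes the sums
   [d_j + d_i], for fixed [i], equivalent to the whole family [d]. *)
Definition cpk (t : bits T) (j : 'I_n.+1) : bool := tnth t (lshift n j).
Definition dpk (t : bits T) (j : 'I_n.+1) : bool :=
  if unlift ord0 j is Some j' then tnth t (rshift n.+1 j') else false.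

Lemma packets_inj (t t' : bits T) : cpk t =1 cpk t' -> dpk t =1 dpk t' -> t = t'.
Proof.
move=> eq_c eq_d; apply: eq_from_tnth => r.
case: (split_ordP r) => j ->; first exact: eq_c.
by have := eq_d (lift ord0 j); rewrite /dpk liftK.
Qed.

Lemma dpk_inj_sums (t t' : bits T) i :
  (forall j, j != i -> dpk t j (+) dpk t i = dpk t' j (+) dpk t' i) ->
  dpk t =1 dpk t'.
Proof.
move=> eq_sum.
have dpk0 u : dpk u ord0 = false by rewrite /dpk unlift_none.
have eq_i : dpk t i = dpk t' i.
  (* For [i] other than 0, the sum with [j] = 0 is the bit [dpk t i] itself. *)
  case: (eqVneq ord0 i) => [<-|/eq_sum]; first by rewrite !dpk0.
  by rewrite !dpk0.
move=> j; case: (eqVneq j i) => [->|/eq_sum] //.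
by rewrite eq_i; apply: addIb.
Qed.

End Packets.

(** * Coding for pairs of transversals *)

Section Grid.

Variables (K n m : nat) (grp : 'I_n.+1 -> {set 'I_K}).
Variable node : 'I_m -> 'I_n.+1 -> 'I_K.

Hypothesis node_in : forall a i, node a i \in grp i.
Hypothesis node_onto :
  forall p, (forall i, p i \in grp i) -> exists a, node a =1 p.
Hypothesis node_inj : forall a b, node a =1 node b -> a = b.

Local Notation T := (n.+1 + n)%N.

Definition differ (a b : 'I_m) : {set 'I_n.+1} := [set i | node a i != node b i].

Lemma differC a b : differ a b = differ b a.
Proof. by apply/setP=> i; rewrite !inE eq_sym. Qed.

Lemma differ0 a b : (differ a b == set0) = (a == b).
Proof.
apply/eqP/eqP=> [dab | ->]; last by apply/setP=> i; rewrite !inE eqxx.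
apply: node_inj => i; apply/eqP/negPn.
by have := in_set0 i; rewrite -dab inE => ->.
Qed.

(** Under [node_onto] the search always succeeds, so the default [a] is harmless. *)
Definition mix (l : 'I_n.+1) (a b : 'I_m) : 'I_m :=
  odflt a [pick c | [forall i, node c i == node (if i == l then b else a) i]].

Lemma node_mix l a b i : node (mix l a b) i = node (if i == l then b else a) i.
Proof.
rewrite /mix; case: pickP => [c /forallP/(_ i)/eqP // | none].
have [c cE] := node_onto (fun i => node_in (if i == l then b else a) i).
by have /forallP[] := none c; move=> j; rewrite cE.
Qed.

Definition swap (l : 'I_n.+1) (p : 'I_m * 'I_m) : 'I_m * 'I_m :=
  (mix l p.1 p.2, mix l p.2 p.1).

Lemma swapK l : involutive (swap l).
Proof.
case=> a b; congr pair; apply: node_inj => i; rewrite !node_mix /=;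
  by case: ifP => il; rewrite node_mix il.
Qed.

Definition opposite (p : 'I_m * 'I_m) : bool := differ p.1 p.2 == setT.

Lemma oppositeP p : reflect (forall i, node p.1 i != node p.2 i) (opposite p).
Proof.
apply: (iffP eqP) => [pT i | H]; first by have := in_setT i; rewrite -pT inE.
by apply/setP=> i; rewrite !inE H.
Qed.

Lemma opposite_swap l p : opposite (swap l p) = opposite p.
Proof.
apply/oppositeP/oppositeP=> H i; have := H i; rewrite !node_mix;
  by case: ifP => _; rewrite // eq_sym.
Qed.

(* All terms involve values of files stored at the node [node p.2 j], since
   swapping a coordinate [l != j] does not change the [j]-th node. *)
Definition opp_msg (w : 'I_m * 'I_m -> bits T) (p : 'I_m * 'I_m)
    (j : 'I_n.+1) : bool :=
  cpk (w p) j (+) \big[addb/false]_(l | l != j)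
                     (dpk (w (swap l p)) j (+) dpk (w (swap l p)) l).

Lemma opp_msg_local w w' p j :
  (forall q, node q.2 j = node p.2 j -> w q = w' q) ->
  opp_msg w p j = opp_msg w' p j.
Proof.
move=> eq_w; rewrite /opp_msg eq_w //; congr addb.
apply: eq_bigr => l lj; rewrite eq_w //= node_mix.
by rewrite eq_sym (negPf lj).
Qed.

Lemma opp_msg_decodable (w w' : 'I_m * 'I_m -> bits T) (k : 'I_K)
    (i : 'I_n.+1) :
  (forall q, node q.2 i = k -> w q = w' q) ->
  (forall p j, opposite p -> opp_msg w p j = opp_msg w' p j) ->
  forall p, opposite p -> node p.1 i = k -> w p = w' p.
Proof.
move=> known eq_msg.
(* In the [j]-th message of [swap i p] the value at [p] occurs as the term
   [l = i], and [k] knows the values in all the other terms. *)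
have eq_d p : opposite p -> node p.1 i = k -> dpk (w p) =1 dpk (w' p).
  move=> opp_p pk; apply: (@dpk_inj_sums _ _ _ i) => j ji.
  have known_swap : w (swap i p) = w' (swap i p).
    by apply: known; rewrite node_mix eqxx.
  have := eq_msg (swap i p) j; rewrite opposite_swap => /(_ opp_p).
  rewrite /opp_msg known_swap => /addbI.
  rewrite !(bigD1 (P := fun l => l != j) i) 1?eq_sym //= swapK.
  rewrite [X in _ = addb _ X](eq_bigr (fun l =>
    dpk (w (swap l (swap i p))) j (+) dpk (w (swap l (swap i p))) l)).
    by apply: addIb.
  move=> l /andP[_ li]; rewrite known //= !node_mix.
  by rewrite eq_sym (negPf li) node_mix eqxx.
move=> p opp_p pk; apply: packets_inj (eq_d p opp_p pk) => j.
have := eq_msg p j opp_p; rewrite /opp_msg.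
rewrite [X in _ = addb _ X](eq_bigr (fun l =>
  dpk (w (swap l p)) j (+) dpk (w (swap l p)) l)); first by apply: addIb.
(* For [l] = [i] the second entry of the swapped pair contains [k], so the value is known; otherwise
   the first entry still contains [k] at [i], and [eq_d] applies. *)
move=> l _; case: (eqVneq i l) => [<-|il].
  by rewrite known // node_mix eqxx.
by rewrite !eq_d ?opposite_swap // node_mix (negPf il).
Qed.

(** * Counting pairs of transversals *)

Lemma card_differ a (A : {set 'I_n.+1}) :
  #|[set b | differ a b == A]| = (\prod_(i in A) #|grp i|.-1)%N.
Proof.
(* The [b] in question are the free choices of another node in each group of [A], with the node of
   [a] kept elsewhere. *)
pose F i := if i \in A then grp i :\ node a i else [set node a i].
pose h b : {ffun 'I_n.+1 -> 'I_K} := [ffun i => node b i].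
have h_inj : injective h.
  by move=> b b' /ffunP eq_h; apply: node_inj => i; have := eq_h i; rewrite !ffunE.
rewrite -(card_imset _ h_inj).
have -> : [set h b | b in [set b | differ a b == A]] = [set p in family F].
  apply/setP=> p; rewrite [RHS]inE; apply/imsetP/familyP=> [[b] | pF].
    rewrite inE => /eqP dA -> i; rewrite ffunE /F -dA !inE.
    by case: (eqVneq (node a i)) => [->|ab]; rewrite !inE ?eqxx // eq_sym ab node_in.
  have [|b bE] := @node_onto p.
    move=> i; have := pF i; rewrite /F; case: ifP => _; first by case/setD1P.
    by move/set1P->.
  exists b; last by apply/ffunP=> i; rewrite ffunE bE.
  rewrite inE; apply/eqP/setP=> i; rewrite inE bE; have := pF i.
  by rewrite /F; case: ifP => _; rewrite !inE; [case/andP; rewrite eq_sym | move/eqP->; rewrite eqxx].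
rewrite cardsE card_family foldrE big_map big_enum /= [RHS]big_mkcond.
apply: eq_bigr => i _; rewrite /F; case: ifP => _; last by rewrite cards1.
by rewrite (cardsD1 (node a i) (grp i)) node_in.
Qed.

Lemma card_opposite :
  #|[set p | opposite p]| = (m * \prod_i #|grp i|.-1)%N.
Proof.
rewrite -sum1_card (eq_bigl (fun p => predT p.1 && opposite (p.1, p.2))); last first.
  by case=> a b; rewrite inE.
rewrite -(pair_big_dep predT (fun a b => opposite (a, b)) (fun _ _ => 1%N)) /=.
rewrite (eq_bigr (fun=> (\prod_i #|grp i|.-1)%N)) => [|a _].
  by rewrite sum_nat_const card_ord.
rewrite sum1_card -[LHS]cardsE (card_differ a setT).
by apply: eq_bigl => i; rewrite inE.
Qed.

(** The order keeps one of (a, b) and (b, a), which share a message, and drops a = b, where every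
    node needing the value has mapped it. *)
Definition overlapping (p : 'I_m * 'I_m) : bool :=
  (p.1 < p.2)%N && ~~ opposite p.

(** Twice the count is the number of ordered pairs of distinct, non-opposite transversals. Sorting
    them by [differ a b], a nonempty proper subset, gives the double sum; hence the factor 1/2 in
    the load. *)
Lemma card_overlapping :
  (2 * #|[set p | overlapping p]| =
   m * \sum_(1 <= g < n.+1) \sum_(A : {set 'I_n.+1} | #|A| == g)
         \prod_(i in A) #|grp i|.-1)%N.
Proof.
pose P g := \prod_(i in (g : {set 'I_n.+1})) #|grp i|.-1.
have -> : (\sum_(1 <= g < n.+1) \sum_(A : {set 'I_n.+1} | #|A| == g) P A =
           \sum_(A : {set 'I_n.+1} | (A != set0) && (A != setT)) P A)%N.
  rewrite (exchange_big_dep predT) //= [RHS]big_mkcond; apply: eq_bigr => A _.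
  rewrite (eq_bigl (fun g => g == #|A|)) => [|g]; last by rewrite eq_sym.
  by rewrite big_nat1_eq card_gt0 (eqEcard A setT) subsetT cardsT card_ord ltnNge.
pose ord (p : 'I_m * 'I_m) := (p.1 != p.2) && ~~ opposite p.
have half : (2 * #|[set p | overlapping p]| = #|[set p | ord p]|)%N.
  pose sw (p : 'I_m * 'I_m) := (p.2, p.1).
  have sw_inj : injective sw by case=> a b [c d] [-> ->].
  rewrite mul2n -addnn -[X in (_ + X)%N](card_imset _ sw_inj) -cardsUI.
  rewrite [X in (_ + X)%N](_ : _ = 0%N) ?addn0; last first.
    apply/eqP; rewrite cards_eq0; apply/eqP/setP=> -[a b]; rewrite !inE.
    apply/negP=> /andP[/andP[/= ab _] /imsetP[[c d]]].
    by rewrite inE => /andP[/= cd _] [? ?]; subst; rewrite ltnNge ltnW in ab.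
  apply: eq_card => -[a b]; rewrite !inE /overlapping /ord /=.
  rewrite -[(a, b) \in _](_ : overlapping (b, a) = _); last first.
    apply/idP/imsetP=> [ba | [[c d]]]; first by exists (b, a); rewrite ?inE.
    by rewrite inE => cd [-> ->].
  rewrite /overlapping /opposite /= (differC b a) -andb_orl.
  by rewrite -neq_ltn.
rewrite half -sum1_card.
rewrite (eq_bigl (fun p => predT p.1 && ord (p.1, p.2))); last first.
  by case=> a b; rewrite inE.
rewrite -(pair_big_dep predT (fun a b => ord (a, b)) (fun _ _ => 1%N)) /=.
rewrite -[X in (X * _)%N]card_ord -sum_nat_const; apply: eq_bigr => a _.
rewrite (partition_big (differ a) (fun A => (A != set0) && (A != setT))) => [|b].
  apply: eq_bigr => A /andP[A0 AT]; rewrite -[P A](card_differ a) -sum1_card.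
  apply: eq_bigl => b; rewrite inE /ord /opposite /= -differ0.
  by case: (eqVneq (differ a b) A) => [->|_]; rewrite ?A0 ?AT ?andbF.
by rewrite /ord /opposite /= -differ0.
Qed.

End Grid.

(** * Assembly of the shuffle scheme *)

Lemma restrictP (Q N T : nat) (P : {set 'I_Q * 'I_N}) (v v' : realization Q N T) :
  restrict P v = restrict P v' <-> {in P, v =1 v'}.
Proof.
split=> [/ffunP eq_v p Pp | eq_v]; first by have := eq_v (Sub p Pp); rewrite !ffunE.
by apply/ffunP=> q; rewrite !ffunE eq_v // (valP q).
Qed.

Lemma mem_comb_storage (K N Q s : nat) (x : 'I_s -> nat) (eta1 eta2 : nat)
    (C : combinatorial_assignment K N Q x eta1 eta2) k b w :
  w \in file_block C b -> (w \in comb_storage C k) = (k \in transv C b).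
Proof.
move=> wb; apply/bigcupP/idP=> [[a ka wa] | kb]; last by exists b.
have [disjF _] := file_partition C.
by case: (eqVneq a b) => [<- //|/disjF/disjointFr/(_ wa)]; rewrite wb.
Qed.

(** Each of the [eta2 * eta1] function-file choices in a pair of blocks is coded separately: an
    overlapping pair costs the 2 s - 1 bits of one value, an opposite pair s bits, where s = n +
    1. *)
Lemma comb_scheme (K N Q n : nat) (x : 'I_n.+1 -> nat) (eta1 eta2 : nat)
    (C : combinatorial_assignment K N Q x eta1 eta2) node :
  (forall a i, node a i \in group C i) ->
  (forall p, (forall i, p i \in group C i) -> exists a, node a =1 p) ->
  (forall a b, node a =1 node b -> a = b) ->
  (forall a, transv C a = [set node a i | i : 'I_n.+1]) ->
  exists S : shuffle_scheme (comb_storage C) (comb_functions C) (n.+1 + n),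
    reduce_succeeds S /\
    (\sum_(k < K) msg_len S k =
       #|[set p | overlapping node p]| * (eta2 * eta1) * (n.+1 + n) +
       #|[set p | opposite node p]| * (eta2 * eta1) * n.+1)%N.
Proof.
move=> node_in node_onto node_inj transvE.
have [fg [fgB fg_onto]] := block_index (fun_partition C) (card_fun_block C).
have [wg [wgB wg_onto]] := block_index (file_partition C) (card_file_block C).
have mem_transv a i : node a i \in transv C a by rewrite transvE imset_f.
have transv_node a b i : node a i \in transv C b -> node a i = node b i.
  rewrite transvE => /imsetP[j _ aibj].
  case: (eqVneq i j) aibj => [-> //|ij aibj].
  have /disjointFr/(_ (node_in a i)) := (group_partition C).1 _ _ ij.
  by rewrite aibj node_in.
pose block (v : realization Q N (n.+1 + n)) (e : 'I_eta2 * 'I_eta1)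
    (p : 'I_(\prod_(i < n.+1) x i) * 'I_(\prod_(i < n.+1) x i)) :=
  v (fg p.1 e.1, wg p.2 e.2).
pose Index := ({p | overlapping node p} * ('I_eta2 * 'I_eta1) * 'I_(n.+1 + n)
               + {p | opposite node p} * ('I_eta2 * 'I_eta1) * 'I_n.+1)%type.
(* Overlapping pairs share a node, so they never reach the default. *)
pose common p := odflt ord0 [pick i | node p.1 i == node p.2 i].
have commonP p : overlapping node p -> node p.1 (common p) = node p.2 (common p).
  case/andP=> _ /oppositeP opp_p; rewrite /common; case: pickP => [i /eqP //|none].
  by case: opp_p => i; rewrite none.
pose owner (j : Index) : 'I_K :=
  match j with
  | inl (p, e, t) => node (val p).1 (common (val p))
  | inr (p, e, t) => node (val p).2 t
  end.
pose f (j : Index) v : bool :=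
  match j with
  | inl (p, e, t) => tnth (block v e (val p)) t
                     (+) tnth (block v e ((val p).2, (val p).1)) t
  | inr (p, e, t) => opp_msg node (block v e) (val p) t
  end.
have known k v v' :
    restrict (mapped Q (comb_storage C) k) v =
      restrict (mapped Q (comb_storage C) k) v' ->
    forall e p, k \in transv C p.2 -> block v e p = block v' e p.
  move/restrictP=> eq_v e p kp; apply: eq_v.
  by rewrite inE /= (mem_comb_storage _ (wgB _ _)).
have [||S [succS lenS]] :=
    @scheme_of_bits K N Q (n.+1 + n) (comb_storage C) (comb_functions C)
      Index owner f.
- case=> [[[[p ov_p] e] t] | [[[p opp_p] e] t]] v v' /known eq_v /=.
    by rewrite !eq_v //= commonP.
  by apply: opp_msg_local => // q eq_q; apply: eq_v; rewrite /= -eq_q.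
- move=> k v v' /known eq_k eq_f; apply/restrictP => -[q w].
  rewrite inE /= => /bigcupP[a0 ka0 qa0].
  have [a [e1 qE]] := fg_onto q; have [b [e2 wE]] := wg_onto w.
  have ka : k \in transv C a.
    have [disjF _] := fun_partition C.
    case: (eqVneq a0 a) => [<- //|/disjF/disjointFr/(_ qa0)].
    by rewrite -qE fgB.
  rewrite -qE -wE -[v _]/(block v (e1, e2) (a, b)) -[v' _]/(block v' (e1, e2) (a, b)).
  have [opp_ab|nopp] := boolP (opposite node (a, b)).
    move: ka; rewrite transvE => /imsetP[i _ kE].
    apply: (opp_msg_decodable node_in node_onto node_inj (k := k) (i := i)) => //.
      by move=> p pk; apply: eq_k; rewrite -pk.
    by move=> p j opp_p; apply: (eq_f (inr (Sub p opp_p, (e1, e2), j))).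
  (* Since [k] lies in transversal [a], it knows the summand v(b, a) and can cancel it. *)
  have eq_ba := eq_k (e1, e2) (b, a) ka.
  case: (ltngtP a b) => [ab | ba | /val_inj eq_ab].
  + have ov : overlapping node (a, b) by rewrite /overlapping ab.
    apply: eq_from_tnth => t.
    have /= := eq_f (inl (Sub (a, b) ov, (e1, e2), t)).
    by rewrite eq_ba; apply: addIb.
  + have ov : overlapping node (b, a).
      by rewrite /overlapping ba /opposite /= differC.
    apply: eq_from_tnth => t.
    have /= := eq_f (inl (Sub (b, a) ov, (e1, e2), t)).
    by rewrite eq_ba; apply: addbI.
  (* Here the required value is one that [k] mapped. *)
  + by rewrite -eq_ab in eq_ba *.
exists S; split=> //; rewrite lenS card_sum !card_prod !card_sig !card_ord.
by rewrite !cardsE.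
Qed.

(** * The two loads *)

Lemma comb_computation_load (K N Q s : nat) (x : 'I_s -> nat) (eta1 eta2 : nat)
    (C : combinatorial_assignment K N Q x eta1 eta2) node :
  (0 < Q)%N -> (0 < N)%N ->
  (forall a i, node a i \in group C i) ->
  (forall a, transv C a = [set node a i | i : 'I_s]) ->
  computation_load Q (comb_storage C) = s%:R.
Proof.
move=> Q0 N0 node_in transvE.
have [disjG _] := group_partition C.
have card_transv a : #|transv C a| = s.
  rewrite transvE card_imset ?card_ord // => i j eq_ij.
  apply/eqP/negPn/negP=> /disjG/disjointFr/(_ (node_in a i)).
  by rewrite eq_ij node_in.
rewrite /computation_load.
have -> : (\sum_(k < K) #|mapped Q (comb_storage C) k| = s * (Q * N))%N.
  transitivity (\sum_(p : 'I_Q * 'I_N) s)%N; last first.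
    by rewrite sum_nat_const card_prod !card_ord mulnC.
  transitivity (\sum_(k < K) \sum_(p : 'I_Q * 'I_N) (p.2 \in comb_storage C k))%N.
    apply: eq_bigr => k _; rewrite -sum1_card big_mkcond.
    by apply: eq_bigr => p _; rewrite inE; case: ifP.
  (* Double counting: each value is mapped exactly by the [s] nodes of the transversal whose block
     holds its file. *)
  rewrite exchange_big; apply: eq_bigr => -[q w] _ /=.
  have [_ covF] := file_partition C.
  have /bigcupP[b _ wb] : w \in \bigcup_a file_block C a by rewrite covF inE.
  rewrite -[RHS](card_transv b) -sum1_card [RHS]big_mkcond.
  by apply: eq_bigr => k _; rewrite (mem_comb_storage _ wb); case: ifP.
by rewrite natrM mulfK // pnatr_eq0 -lt0n muln_gt0 Q0.
Qed.

Theorem theorem1 (s : nat) (x : 'I_s -> nat) (eta1 eta2 X K N Q : nat)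
    (hs : (2 <= s)%N) (hx : forall i, (2 <= x i)%N)
    (heta1 : (0 < eta1)%N) (heta2 : (0 < eta2)%N)
    (hX : X = (\prod_(i < s) x i)%N) (hK : K = (\sum_(i < s) x i)%N)
    (hN : N = (eta1 * X)%N) (hQ : Q = (eta2 * X)%N)
    (C : combinatorial_assignment K N Q x eta1 eta2) :
  achievable (comb_storage C) (comb_functions C)
    (s%:R)
    (1 / (2 * X%:R) *
       (\sum_(1 <= g < s) \sum_(A : {set 'I_s} | #|A| == g)
          \prod_(i in A) ((x i)%:R - 1))
     + s%:R / (X%:R * (2 * s%:R - 1)) * \prod_(i < s) ((x i)%:R - 1)).
Proof.
have X0 : (0 < X)%N by rewrite hX prodn_gt0 // => i; apply: ltnW.
have Q0 : (0 < Q)%N by rewrite hQ muln_gt0 heta2.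
have N0 : (0 < N)%N by rewrite hN muln_gt0 heta1.
case: s hs x hx hX hK C => // n _ x hx hX _ C.
have [node [node_in node_onto node_inj transvE]] := coordinates C.
exists (n.+1 + n)%N; split=> //; split.
  exact: comb_computation_load node_in transvE.
have [S [succS lenS]] := comb_scheme node_in node_onto node_inj transvE.
exists S; split=> //.
have predE i : ((x i)%:R - 1 : rat) = (#|group C i|.-1)%:R.
  by rewrite card_group -subn1 natrB // ltnW.
have sumE : (\sum_(1 <= g < n.+1) \sum_(A : {set 'I_n.+1} | #|A| == g)
               \prod_(i in A) ((x i)%:R - 1) : rat) * X%:R =
            2 * (#|[set p | overlapping node p]|)%:R.
  rewrite -(natrM _ 2) (card_overlapping node_in node_onto node_inj) -hX.
  rewrite natrM natr_sum mulrC; congr (_ * _); apply: eq_bigr => g _.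
  rewrite natr_sum; apply: eq_bigr => A _; rewrite natr_prod.
  by apply: eq_bigr => i _; rewrite predE.
have oppE : (\prod_(i < n.+1) ((x i)%:R - 1) : rat) * X%:R =
            (#|[set p | opposite node p]|)%:R.
  rewrite (card_opposite node_in node_onto node_inj) -hX natrM natr_prod mulrC.
  by congr (_ * _); apply: eq_bigr => i _; rewrite predE.
rewrite /communication_load lenS hQ hN.
rewrite !(natrD, natrM) -oppE.
rewrite (_ : #|_|%:R = (\sum_(1 <= g < n.+1) \sum_(A : {set 'I_n.+1} | #|A| == g)
               \prod_(i in A) ((x i)%:R - 1) : rat) * X%:R / 2); last first.
  by rewrite sumE mulrC mulKf // pnatr_eq0.
set Sg := \sum_(1 <= g < _) _; set Pr := \prod_(i < _) _.
(* The factor 2 s - 1 is the number of bits per value, hence nonzero in [rat]. *)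
field; rewrite (_ : 2 * (1 + n%:R) - 1 = (n.+1 + n)%:R); last first.
  by rewrite natrD -natr1; ring.
by rewrite !pnatr_eq0 -!lt0n X0 heta1 heta2.
Qed.
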